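(* Let $\Omega\subset\mathbb{R}^n$ be bounded and let $K:\mathbb{R}^n\times\mathbb{R}^n\to[0,+\infty]$ be a measurable symmetric kernel. Assume that $K$ has the compactness property in $\Omega$, and that $$K(x,y)>0\qquad\text{for a.e. }(x,y)\in\Omega\times\Omega^c.$$ Let $h\in L^1(\Omega)$. Let $I\subset\mathbb{R}$ and let $\{G^{(t)}\}_{t\in I}$ be a family of exterior data $G^{(t)}\subset\Omega^c$. Assume that, for each $t\in I$, there is an admissible set of finite $K$-perimeter with exterior datum $G^{(t)}$ (i.e. a set $E$ with $E\setminus\Omega=G^{(t)}$ and $\operatorname{Per}_K(E,\Omega)<+\infty$). Assume also that, whenever $\tau,t\in I$ and $\tau<t$, $$G^{(\tau)}\subsetneq G^{(t)}\qquad\text{in }\Omega^c.$$ Then the set of parameters $t\in I$ for which the minimizer of $$\mathcal F_{K,h}(E,\Omega):=\operatorname{Per}_K(E,\Omega)+\int_\Omega h(x)\chi_E(x)\,dx$$ among sets $E$ with $E\setminus\Omega=G^{(t)}$ is not unique is at most countable.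
   Context: All sets are measurable, and identities between sets (equalities, inclusions, strict inclusions, uniqueness) are understood up to sets of Lebesgue measure zero. The superscript $c$ denotes the complement in $\mathbb{R}^n$. Symmetric means $K(x,y)=K(y,x)$. The relative $K$-perimeter is $$\operatorname{Per}_K(E,\Omega):=\Big(\int_{E\cap\Omega}\int_{E^c\cap\Omega}+\int_{E\cap\Omega}\int_{E^c\cap\Omega^c}+\int_{E\cap\Omega^c}\int_{E^c\cap\Omega}\Big)K(x,y)\,dy\,dx=\frac12\iint_{\mathbb{R}^{2n}\setminus(\Omega^c)^2}|\chi_E(x)-\chi_E(y)|^2K(x,y)\,dx\,dy.$$ Compactness property: $K$ has the compactness property in $\Omega$ if for every $G\subset\Omega^c$ and every sequence $E_j$ with $E_j\setminus\Omega=G$ and $\sup_j\operatorname{Per}_K(E_j,\Omega)<+\infty$ there exist a subsequence (not relabeled) and a set $E$ with $E\setminus\Omega=G$ such that $\chi_{E_j}\to\chi_E$ in $L^1(\Omega)$ and $\operatorname{Per}_K(E,\Omega)\le\liminf_{j\to+\infty}\operatorname{Per}_K(E_j,\Omega)$. *)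

(* Defs.v *)
From HB Require Import structures.
From mathcomp Require Import all_boot all_order all_algebra.
From mathcomp Require Import all_classical all_reals all_analysis.
From mathcomp Require Import measurable_realfun.

Set Implicit Arguments.
Unset Strict Implicit.
Unset Printing Implicit Defensive.

Import Order.TTheory GRing.Theory Num.Theory.
Import numFieldNormedType.Exports.

Local Open Scope classical_set_scope.
Local Open Scope ring_scope.
Local Open Scope ereal_scope.

Lemma sigma_finite_product_measure1 d1 d2 (T1 : measurableType d1)
    (T2 : measurableType d2) (R : realType)
    (m1 : {sigma_finite_measure set T1 -> \bar R})
    (m2 : {sigma_finite_measure set T2 -> \bar R}) :
  sigma_finite setT (m1 \x m2).
Proof.
have /sigma_finiteP[F [TF ndF Foo]] := sigma_finiteT m1.
have /sigma_finiteP[G [TG ndG Goo]] := sigma_finiteT m2.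
exists (fun k => F k `*` G k).
  rewrite -setXTT TF TG predeqE => -[x y]; split.
    move=> [/= [n _ Fnx] [k _ Gky]]; exists (maxn n k) => //; split.
    - by move: x Fnx; exact/subsetPset/ndF/leq_maxl.
    - by move: y Gky; exact/subsetPset/ndG/leq_maxr.
  by move=> [n _ []/= ? ?]; split; exists n.
move=> k; have [? ?] := Foo k; have [? ?] := Goo k.
split; first exact: measurableX.
by rewrite product_measure1E// lte_mul_pinfty// ge0_fin_numE.
Qed.

Section lebesgue_step.
Context (R : realType) (n : nat).
Variable mu : {sigma_finite_measure set (n.-tuple (measurableTypeR R)) -> \bar R}.

Let cons_tup (p : measurableTypeR R * n.-tuple (measurableTypeR R)) :
  n.+1.-tuple (measurableTypeR R) := [tuple of p.1 :: p.2].

Let measurable_cons_tup : measurable_fun setT cons_tup.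
Proof. exact: measurable_cons. Qed.

(* The image of [lebesgue_measure \x mu] under R * R^n ~ R^(n+1). *)
Definition lebesgue_step : set (n.+1.-tuple (measurableTypeR R)) -> \bar R :=
  pushforward (@lebesgue_measure R \x mu) cons_tup.

Let lebesgue_step0 : lebesgue_step set0 = 0.
Proof. by rewrite /lebesgue_step /pushforward preimage_set0 measure0. Qed.

Let lebesgue_step_ge0 A : 0 <= lebesgue_step A.
Proof. exact: measure_ge0. Qed.

Let lebesgue_step_sigma_additive : semi_sigma_additive lebesgue_step.
Proof.
move=> F mF tF mUF; rewrite /lebesgue_step /pushforward preimage_bigcup.
apply: measure_semi_sigma_additive.
- by move=> k; rewrite -[X in measurable X]setTI; exact: measurable_cons_tup.
- apply/trivIsetP => /= i j _ _ ij; rewrite -preimage_setI.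
  by move/trivIsetP : tF => /(_ _ _ _ _ ij) ->//; rewrite preimage_set0.
- by rewrite -preimage_bigcup -[X in measurable X]setTI;
    exact: measurable_cons_tup.
Qed.

HB.instance Definition _ := isMeasure.Build _ _ _ lebesgue_step
  lebesgue_step0 lebesgue_step_ge0 lebesgue_step_sigma_additive.

Let lebesgue_step_sigma_finite : sigma_finite setT lebesgue_step.
Proof.
have [F FT Ffin] := sigma_finite_product_measure1 (@lebesgue_measure R) mu.
pose g (t : n.+1.-tuple (measurableTypeR R)) :
    measurableTypeR R * n.-tuple (measurableTypeR R) :=
  (tnth t ord0, [tuple of behead t]).
have mg : measurable_fun setT g.
  apply: measurable_fun_pair; first exact: measurable_tnth.
  exact: measurable_behead.
have gK p : g (cons_tup p) = p.
  by case: p => x t; congr pair; apply: val_inj.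
exists (fun k => g @^-1` (F k)).
  by rewrite -preimage_bigcup -FT preimage_setT.
move=> k; have [mFk Fkoo] := Ffin k; split.
  by rewrite -[X in measurable X]setTI; exact: mg.
rewrite /lebesgue_step /pushforward -comp_preimage.
by rewrite (_ : g \o cons_tup = id)//; apply/funext => p /=; rewrite gK.
Qed.

HB.instance Definition _ := Measure_isSigmaFinite.Build _ _ _ lebesgue_step
  lebesgue_step_sigma_finite.

End lebesgue_step.

Section lebesgue.
Context (R : realType).

(* n-dimensional Lebesgue measure on the Borel sets of R^n, as an iterated
   product of one-dimensional Lebesgue measures; R^0 carries the unit mass. *)
Fixpoint borel_lebesgue (n : nat) :
    {sigma_finite_measure set (n.-tuple (measurableTypeR R)) -> \bar R} :=
  match n with
  | 0 => \d_([tuple] : 0.-tuple (measurableTypeR R))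
  | m.+1 => lebesgue_step (borel_lebesgue m)
  end.

(* Lebesgue measure on the Borel sets of R^(2n) = R^n * R^n. *)
Definition borel_lebesgue2 (n : nat) :
    {measure set (n.-tuple (measurableTypeR R) *
                  n.-tuple (measurableTypeR R))%type -> \bar R} :=
  borel_lebesgue n \x borel_lebesgue n.

(* R^n and R^n * R^n carry the sigma-algebra of Lebesgue measurable sets, not
   only that of Borel sets: it is the one of the Caratheodory sets of the outer
   Lebesgue measure. *)
Definition Rn (n : nat) := caratheodory_type (borel_lebesgue n)^*%mu.
HB.instance Definition _ n := Measurable.on (Rn n).
Definition Rn2 (n : nat) := caratheodory_type (borel_lebesgue2 n)^*%mu.
HB.instance Definition _ n := Measurable.on (Rn2 n).

Definition leb (n : nat) : {measure set (Rn n) -> \bar R} :=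
  @completed_measure_extension _ _ _ (borel_lebesgue n).

Definition leb2 (n : nat) : {measure set (Rn2 n) -> \bar R} :=
  @completed_measure_extension _ _ _ (borel_lebesgue2 n).

End lebesgue.

Section perimeter.
Context (R : realType) (n : nat).
Implicit Types (Omega E F G A B : set (Rn R n)) (K : Rn R n -> Rn R n -> \bar R).

(* Relations between sets are up to Lebesgue-null sets. *)
Definition ae_subset A B := \forall x \ae leb R n, A x -> B x.
Definition ae_eqset A B := \forall x \ae leb R n, A x <-> B x.
Definition ae_proper A B := ae_subset A B /\ ~ ae_eqset A B.

(* Through 'rV[R]_n, since tuples carry no norm in the library. *)
Definition boundedRn A := [bounded (\row_(i < n) tnth x i : 'rV[R]_n) | x in A].

Definition symmetric_kernel K :=
  [/\ measurable_fun [set: Rn2 R n] (fun z => K z.1 z.2),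
      (forall x y, 0 <= K x y) & forall x y, K x y = K y x].

(* The double integral of K over A * B, against Lebesgue measure on R^(2n). *)
Definition interaction K A B : \bar R :=
  \int[leb2 R n]_(z in (A `*` B : set (Rn2 R n))) K z.1 z.2.

Definition Per K Omega E : \bar R :=
  interaction K (E `&` Omega) (~` E `&` Omega) +
  interaction K (E `&` Omega) (~` E `&` ~` Omega) +
  interaction K (E `&` ~` Omega) (~` E `&` Omega).

Definition admissible Omega G E :=
  measurable E /\ ae_eqset (E `\` Omega) G.

Definition compactness_property K Omega :=
  forall G, measurable G -> ae_subset G (~` Omega) ->
  forall E : (set (Rn R n))^nat,
    (forall j, admissible Omega G (E j)) ->
    ereal_sup (range (fun j => Per K Omega (E j))) < +oo ->
  exists s : nat -> nat, (forall i j, (i < j)%N -> (s i < s j)%N) /\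
  exists E0 : set (Rn R n),
    [/\ admissible Omega G E0,
        \int[leb R n]_(x in Omega) (`|\1_(E (s j)) x - \1_E0 x|%R)%:E
          @[j --> \oo] --> 0 &
        Per K Omega E0 <= limn_einf (fun j => Per K Omega (E (s j)))].

Definition energy K (h : Rn R n -> R) Omega E : \bar R :=
  Per K Omega E + \int[leb R n]_(x in Omega) (h x * \1_E x)%:E.

Definition minimizer K (h : Rn R n -> R) Omega G E :=
  admissible Omega G E /\
  forall F, admissible Omega G F -> energy K h Omega E <= energy K h Omega F.

(* Existence, and uniqueness up to null sets. *)
Definition has_unique_minimizer K (h : Rn R n -> R) Omega G :=
  exists2 E, minimizer K h Omega G E &
    forall F, minimizer K h Omega G F -> ae_eqset F E.

End perimeter.

(* Main.v *)
Require Import Defs.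
From mathcomp Require Import all_boot all_order all_algebra.
From mathcomp Require Import all_classical all_reals all_analysis.
From mathcomp Require Import measurable_realfun.
Set Implicit Arguments.
Unset Strict Implicit.
Unset Printing Implicit Defensive.
Import Order.TTheory GRing.Theory Num.Theory.
Import numFieldNormedType.Exports.
Local Open Scope classical_set_scope.
Local Open Scope ring_scope.
Local Open Scope ereal_scope.

(* Directed cuts are submodular: for E and F,
   Per(E /\ F) + Per(E \/ F) + D <= Per(E) + Per(F), where the defect D is the
   interaction of (E \ F) /\ Omega with (F \ E) \ Omega, while the term in h is
   modular. If E, F minimize for G(tau) and G(t) with tau < t, then E /\ F and
   E \/ F are competitors for the same data, so D = 0; since K > 0 on
   Omega * Omega^c and F \ E contains the non-null set G(t) \ G(tau) outside
   Omega, E /\ Omega is a.e. contained in F. When t = tau the same computation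
   shows that E /\ F and E \/ F are again minimizers. Hence each parameter t
   without uniqueness yields a nonempty open interval
   ]|E /\ F /\ Omega|, |(E \/ F) /\ Omega|[, and intervals of different
   parameters are disjoint: choosing a rational in each gives an injection. *)

(** * Measurable hulls and completion of a measure *)

(** Intersect unions of countable covers whose excess over the outer measure is at most 1/(k+1);
    when the outer measure is infinite, the whole space works. *)
Lemma measurable_hull d (T : measurableType d) (R : realType)
    (mu : {measure set T -> \bar R}) (X : set T) :
  exists F : set T, [/\ measurable F, X `<=` F & mu F = (mu^*)%mu X].
Proof.
have [Xoo|Xoo] := eqVneq ((mu^*)%mu X) +oo.
  exists setT; split => //; apply/eqP; rewrite eq_le Xoo leey/= -Xoo.
  by rewrite -(measurable_mu_extE mu measurableT) le_mu_ext.
have Xfin : (mu^*)%mu X \is a fin_num.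
  by rewrite ge0_fin_numE ?ltey//; exact: outer_measure_ge0.
have /choice[F HF] : forall k : nat, exists F : set T,
    [/\ measurable F, X `<=` F & mu F <= (mu^*)%mu X + k.+1%:R^-1%:E].
  move=> k; have k0 : (0 < k.+1%:R^-1 :> R)%R by rewrite invr_gt0.
  have [_ [A [mA XA] <-] /ltW AX] := lb_ereal_inf_adherent k0 Xfin.
  exists (\bigcup_i A i); split => //; first exact: bigcupT_measurable.
  apply: le_trans AX; apply: measure_sigma_subadditive => //.
  exact: bigcupT_measurable.
have mF : measurable (\bigcap_k F k).
  by apply: bigcapT_measurable => k; have [] := HF k.
exists (\bigcap_k F k); split => //.
  by apply: sub_bigcap => k _; have [] := HF k.
apply/eqP; rewrite eq_le; apply/andP; split; last first.
  rewrite -(measurable_mu_extE mu mF) le_mu_ext//.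
  by apply: sub_bigcap => k _; have [] := HF k.
apply/lee_addgt0Pr => _/posnumP[e]; near \oo => k.
apply: (@le_trans _ _ (mu (F k))).
  by apply: le_measure; rewrite ?inE//; [have [] := HF k|exact: bigcap_inf].
have [_ _ Fk] := HF k; rewrite (le_trans Fk)// leeD2l// lee_fin ltW//.
by near: k; exact: near_infty_natSinv_lt.
Unshelve. all: by end_near. Qed.

Section completion.
Context d (T : measurableType d) (R : realType).
Variable mu : {measure set T -> \bar R}.
Local Notation cmu := (@completed_measure_extension _ _ _ mu).

Lemma completed_measureE (A : set T) : measurable A -> cmu A = mu A.
Proof. exact: measurable_mu_extE. Qed.

Lemma measurable_completed (A : set T) : measurable A ->
  measurable (A : set (caratheodory_type (mu^*)%mu)).
Proof. exact: caratheodory_measurable_mu_ext. Qed.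

(** [cmu] is the outer measure, so it has a value on [N] before [N] is known to be measurable. A
    hull of [N] is null, and the Caratheodory measure is complete. *)
Lemma completed_null_measurable (N : set (caratheodory_type (mu^*)%mu)) :
  cmu N = 0 -> measurable N.
Proof.
move=> N0; have [F [mF NF muF]] := measurable_hull mu N.
apply: (@measure_is_complete_caratheodory R T (mu^*)%mu).
exists F; split => //; first exact: measurable_completed.
by rewrite -[LHS]/(cmu F) completed_measureE// muF.
Qed.

(** Inner approximation from hulls: on each piece of finite measure, take a hull [F] of [A], then
    remove from [F] a hull [N] of the null set [F] minus [A]. What remains lies in [A], and what [A]
    loses lies in [N]. *)
Lemma measurable_core (A : set (caratheodory_type (mu^*)%mu)) :
  sigma_finite setT mu -> measurable A ->
  exists B : set T, [/\ measurable B, B `<=` A & cmu (A `\` B) = 0].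
Proof.
move=> [S ST Sfin] mA.
have mS k : measurable (S k : set (caratheodory_type (mu^*)%mu)).
  by apply: measurable_completed; have [] := Sfin k.
have /choice[B HB] : forall k : nat, exists B : set T,
    [/\ measurable B, B `<=` A `&` S k & cmu ((A `&` S k) `\` B) = 0].
  move=> k; pose Ak : set (caratheodory_type (mu^*)%mu) := A `&` S k.
  have mAk : measurable Ak by exact: measurableI.
  have Akoo : cmu Ak < +oo.
    have [mSk Skoo] := Sfin k; rewrite (le_lt_trans _ Skoo)//.
    rewrite -completed_measureE//; apply: le_measure; rewrite ?inE//.
    exact: subIsetr.
  have [F [mF AF muF]] := measurable_hull mu Ak.
  have mF' := measurable_completed mF.
  have FA0 : cmu (F `\` Ak) = 0.
    have FAk : cmu F = cmu Ak by rewrite completed_measureE.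
    have Foo : cmu F < +oo by rewrite FAk.
    rewrite [LHS](measureD mF' mAk Foo) setIidr//.
    rewrite -[LHS]/(cmu F - cmu Ak) FAk subee// ge0_fin_numE//.
  have [N [mN FN muN]] := measurable_hull mu (F `\` Ak).
  exists (F `\` N); split; first exact: measurableD.
    by move=> x [Fx Nx]; apply: contrapT => Akx; apply: Nx; apply: FN; split.
  apply/eqP; rewrite -measure_le0 -FA0 /= -[leRHS]muN.
  rewrite -completed_measureE//; apply: le_outer_measure.
  move=> x [Akx FNx]; apply: contrapT => Nx; apply: FNx; split => //.
  exact: AF.
exists (\bigcup_k B k); split.
- by apply: bigcupT_measurable => k; have [] := HB k.
- by move=> x [k _ Bx]; have [_ /(_ _ Bx)[]] := HB k.
- have /negligibleP : cmu.-negligible (\bigcup_k ((A `&` S k) `\` B k)).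
    apply: negligible_bigcup => k; apply/negligibleP; last by have [] := HB k.
    by apply: completed_null_measurable; have [] := HB k.
  move=> H; apply/eqP; rewrite -measure_le0 -H; last first.
    apply: bigcupT_measurable => k.
    by apply: completed_null_measurable; have [] := HB k.
  apply: le_outer_measure => x [Ax Bx].
  have [k _ Sx] : (\bigcup_k S k) x by rewrite -ST.
  by exists k => //; split => // Bkx; apply: Bx; exists k.
Qed.

End completion.

(** * Rectangles in the completed product *)

Section completed_product.
Context d1 d2 (T1 : measurableType d1) (T2 : measurableType d2) (R : realType).
Variables (m1 : {sigma_finite_measure set T1 -> \bar R})
  (m2 : {sigma_finite_measure set T2 -> \bar R}).
Local Notation m := (m1 \x m2).
Local Notation cm1 := (@completed_measure_extension _ _ _ m1).
Local Notation cm2 := (@completed_measure_extension _ _ _ m2).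
Local Notation cm := (@completed_measure_extension _ _ _ m).
Local Notation C1 := (caratheodory_type (m1^*)%mu).
Local Notation C2 := (caratheodory_type (m2^*)%mu).
Local Notation C := (caratheodory_type (m^*)%mu).

Lemma completed_product_null1 (N : set C1) (M : set T2) :
  cm1 N = 0 -> cm (N `*` M) = 0.
Proof.
move=> N0; have [F [mF NF muF]] := measurable_hull m1 N.
have F0 : cm (F `*` setT) = 0.
  rewrite [LHS](completed_measureE _ (measurableX mF measurableT)).
  by rewrite [LHS]product_measure1E// muF [X in X * _]N0 mul0e.
apply/eqP; rewrite -measure_le0 -F0; apply: le_outer_measure.
by move=> [x y] /= [Nx _]; split => //; exact: NF.
Qed.

Lemma completed_product_null2 (M : set T1) (N : set C2) :
  cm2 N = 0 -> cm (M `*` N) = 0.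
Proof.
move=> N0; have [F [mF NF muF]] := measurable_hull m2 N.
have F0 : cm (setT `*` F) = 0.
  rewrite [LHS](completed_measureE _ (measurableX measurableT mF)).
  by rewrite [LHS]product_measure1E// muF [X in _ * X]N0 mule0.
apply/eqP; rewrite -measure_le0 -F0; apply: le_outer_measure.
by move=> [x y] /= [_ Ny]; split => //; exact: NF.
Qed.

(** The rectangle is the product of two cores, measurable before completion, together with two null
    strips, measurable by completeness. *)
Lemma completed_measurableX (A : set C1) (B : set C2) :
  measurable A -> measurable B -> measurable (A `*` B : set C).
Proof.
move=> mA mB.
have [A0 [mA0 A0A AA0]] := measurable_core (sigma_finiteT m1) mA.
have [B0 [mB0 B0B BB0]] := measurable_core (sigma_finiteT m2) mB.
have -> : (A `*` B : set C) = A0 `*` B0 `|`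
    (A `*` (B `\` B0) `|` (A `\` A0) `*` B).
  apply/seteqP; split => [[x y] [/= Ax By]|[x y] /=].
    have [A0x|A0x] := pselect (A0 x); last by right; right.
    by have [B0y|B0y] := pselect (B0 y); [left|right; left].
  by move=> [[/A0A Ax /B0B By]|[[Ax [By _]]|[[Ax _] By]]].
apply: measurableU.
  by apply: measurable_completed; exact: measurableX.
apply: measurableU; apply: completed_null_measurable.
- exact: completed_product_null2.
- exact: completed_product_null1.
Qed.

(** The product formula holds before completion, so it is applied to cores of [A] and [B]; a set
    with a null core is null. *)
Lemma completed_productX_eq0 (A : set C1) (B : set C2) :
  measurable A -> measurable B -> cm (A `*` B) = 0 -> cm1 A = 0 \/ cm2 B = 0.
Proof.
move=> mA mB AB.
have [A0 [mA0 A0A AA0]] := measurable_core (sigma_finiteT m1) mA.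
have [B0 [mB0 B0B BB0]] := measurable_core (sigma_finiteT m2) mB.
have /eqP : m1 A0 * m2 B0 = 0.
  have -> : m1 A0 * m2 B0 = cm (A0 `*` B0).
    rewrite [RHS](completed_measureE _ (measurableX mA0 mB0)).
    by rewrite [RHS]product_measure1E.
  apply/eqP; rewrite -measure_le0 -AB; apply: le_outer_measure.
  by move=> [x y] [/= /A0A Ax /B0B By].
rewrite mule_eq0 => /orP[] /eqP H0; [left|right].
  have cA0 : cm1 A0 = 0 by rewrite [LHS]completed_measureE.
  rewrite -(setDKU A0A); apply/eqP; rewrite -measure_le0.
  rewrite (le_trans (outer_measureU2 _ _ _))// -[leRHS](adde0 0).
  by apply: leeD; [rewrite [leLHS]AA0|rewrite [leLHS]cA0].
have cB0 : cm2 B0 = 0 by rewrite [LHS]completed_measureE.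
rewrite -(setDKU B0B); apply/eqP; rewrite -measure_le0.
rewrite (le_trans (outer_measureU2 _ _ _))// -[leRHS](adde0 0).
by apply: leeD; [rewrite [leLHS]BB0|rewrite [leLHS]cB0].
Qed.

End completed_product.

(** * Lebesgue measure of rectangles and bounded sets *)

Section lebesgue.
Context (R : realType) (n : nat).
Implicit Types A B : set (Rn R n).

Lemma measurable_Rn2X A B : measurable A -> measurable B ->
  measurable (A `*` B : set (Rn2 R n)).
Proof. exact: completed_measurableX. Qed.

Lemma leb2X_eq0 A B : measurable A -> measurable B ->
  leb2 R n (A `*` B) = 0 -> leb R n A = 0 \/ leb R n B = 0.
Proof. exact: completed_productX_eq0. Qed.

End lebesgue.

Lemma borel_lebesgue_cube (R : realType) (n : nat) (M : R) :
  let Q := [set x : n.-tuple (measurableTypeR R) |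
    forall i, (`|tnth x i| <= M)%R] in
  measurable Q /\ borel_lebesgue R n Q < +oo.
Proof.
elim: n => [|n [mQ Qoo]] /=.
  rewrite (_ : [set _ | _] = setT); last first.
    by apply/seteqP; split => // x _ [].
  by split; [exact: measurableT|rewrite diracT ltry].
set Q := [set _ | _] in mQ Qoo; split.
  rewrite (_ : [set _ | _] = \bigcap_(i in [set: 'I_n.+1])
      (fun x => @tnth n.+1 (measurableTypeR R) x i) @^-1` `[(- M)%R, M]%classic).
    apply: fin_bigcap_measurable => // i _.
    rewrite -[X in measurable X]setTI.
    by apply: (measurable_tnth i measurableT); exact: measurable_itv.
  apply/seteqP; split => [x Hx i _|x Hx i] /=.
    by rewrite in_itv/= -ler_norml.
  by have := Hx i Logic.I; rewrite /= in_itv/= -ler_norml.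
(* The preimage of the cube under [(a, x) |-> a :: x] is an interval times the cube of one dimension
   less. *)
rewrite [ltLHS](_ : _ = (@lebesgue_measure R \x borel_lebesgue R n)
  (`[(- M)%R, M]%classic `*` Q)); last first.
  congr (product_measure1 _ _ _).
  apply/seteqP; split => [[a x]|[a x]] /=.
    move=> H; split => /=; first by have := H ord0; rewrite in_itv/= -ler_norml.
    by move=> i; have := H (lift ord0 i); rewrite tnthS.
  rewrite /= in_itv/= -ler_norml => -[aM Qx] i.
  by case: (unliftP ord0 i) => [j ->|->//]; rewrite tnthS.
have mM : measurable (`[(- M)%R, M]%classic : set (measurableTypeR R)).
  exact: measurable_itv.
rewrite [ltLHS](product_measure1E _ _ mM mQ) lte_mul_pinfty//.
  by rewrite ge0_fin_numE// [ltLHS]lebesgue_measure_itv/=; case: ifP; rewrite ?ltry.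
Qed.

Lemma leb_bounded_lty (R : realType) (n : nat) (A : set (Rn R n)) :
  measurable A -> boundedRn A -> leb R n A < +oo.
Proof.
move=> mA [M [_ HM]].
(* Boundedness gives the estimate only for constants strictly above [M], hence [M + 1]. *)
have [mQ Qoo] := @borel_lebesgue_cube R n (M + 1)%R.
rewrite (le_lt_trans _ Qoo)// -[leRHS](completed_measureE (borel_lebesgue R n))//.
apply: le_outer_measure => x Ax i.
have /= := HM (M + 1)%R (ltr_pwDr ltr01 (lexx _)) x Ax.
apply: le_trans.
(* The norm on rows is the maximum of the absolute values of the entries, one of which is coordinate
   [i]. *)
have /mapP[j Hj xj] : `|tnth x i|%R \in
    [seq `|(\row_(i < n) tnth x i : 'rV[R]_n) k.1 k.2|%R | k : 'I_1 * 'I_n].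
  by apply/mapP; exists (ord0, i) => /=; rewrite ?mem_enum// mxE.
rewrite [leLHS]xj [leRHS]/Num.norm /= mx_normrE.
by apply/bigmax_geP; right => /=; exists j.
Qed.

(** * Submodularity of the perimeter *)

(** Reduces an inequality between sums of integrals of one nonnegative function to counting how
    often each point is covered. Nothing is subtracted, so the value +oo is harmless. *)
Lemma le_integral_multiplicity d (T : measurableType d) (R : realType)
    (mu : {measure set T -> \bar R}) (f : T -> \bar R) (A B S C D : set T) :
  measurable A -> measurable B -> measurable S -> measurable C ->
  measurable D -> measurable_fun setT f -> (forall x, 0 <= f x) ->
  (forall x, (x \in A) + (x \in B) + (x \in S) <= (x \in C) + (x \in D))%N ->
  \int[mu]_(x in A) f x + \int[mu]_(x in B) f x + \int[mu]_(x in S) f x <=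
  \int[mu]_(x in C) f x + \int[mu]_(x in D) f x.
Proof.
move=> mA mB mS mC mD mf f0 le_mult.
have mp (E : set T) : measurable E -> measurable_fun setT (f \_ E).
  by move=> mE; apply/(measurable_restrictT _ mE); exact: measurable_funTS.
have p0 (E : set T) x : setT x -> 0 <= (f \_ E) x.
  by move=> _; rewrite patchE; case: ifP.
rewrite 5!(integral_mkcond _ f).
rewrite -(ge0_integralD mu measurableT (p0 A) (mp _ mA) (p0 B) (mp _ mB)).
rewrite -(ge0_integralD mu measurableT (p0 C) (mp _ mC) (p0 D) (mp _ mD)).
have pAB x : setT x -> 0 <= (f \_ A) x + (f \_ B) x.
  by move=> _; rewrite adde_ge0// p0.
have mAB := emeasurable_funD (mp _ mA) (mp _ mB).
rewrite -(ge0_integralD mu measurableT pAB mAB (p0 S) (mp _ mS)).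
apply: ge0_le_integral => //.
- by move=> x _; rewrite adde_ge0// ?p0// pAB.
- by apply: emeasurable_funD => //; exact: mp.
- by apply: emeasurable_funD; exact: mp.
have patch0 (E : set T) x : (f \_ E) x = if x \in E then f x else 0.
  by rewrite patchE.
move=> x _; rewrite !patch0; have := le_mult x; have := f0 x.
case: (x \in A); case: (x \in B); case: (x \in S); case: (x \in C);
  case: (x \in D) => //= fx0 _; rewrite ?adde0 ?add0e ?leeDl ?adde_ge0 ?lexx//.
Qed.

Section submodularity.
Context (R : realType) (n : nat) (Omega : set (Rn R n)).
Context (K : Rn R n -> Rn R n -> \bar R).
Hypothesis mOmega : measurable Omega.
Hypothesis mK : measurable_fun [set: Rn2 R n] (fun z => K z.1 z.2).
Hypothesis K0 : forall x y, 0 <= K x y.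
Implicit Types E F : set (Rn R n).

Local Notation f := (fun z : Rn2 R n => K z.1 z.2).

(* [K] is integrated over the ordered pairs leaving [E], which avoids any use of
   its symmetry. *)
Definition cut E : set (Rn2 R n) :=
  [set z | [/\ E z.1, ~ E z.2 & Omega z.1 \/ Omega z.2]].

Lemma in_cut E z : (z \in cut E) =
  [&& z.1 \in E, z.2 \notin E & (z.1 \in Omega) || (z.2 \in Omega)].
Proof.
apply/idP/and3P; rewrite inE notin_setE => -[Ez1 Ez2 Oz]; split => //.
- exact/mem_set.
- by apply/orP; case: Oz => /mem_set; [left|right].
- exact/set_mem.
- by case/orP: Oz => /set_mem; [left|right].
Qed.

Lemma cutE E : cut E = ((E `&` Omega) `*` (~` E `&` Omega)) `|`
  ((E `&` Omega) `*` (~` E `&` ~` Omega)) `|`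
  ((E `&` ~` Omega) `*` (~` E `&` Omega)).
Proof.
apply/seteqP; split => [[x y] [/= Ex Ey Oxy]|[x y] /=]; last first.
  move=> [[[[Ex Ox] [Ey Oy]]|[[Ex Ox] [Ey Oy]]]|[[Ex Ox] [Ey Oy]]];
  by split => //; by [left|right].
have [Ox|Ox] := pselect (Omega x); last by right; case: Oxy.
by have [Oy|Oy] := pselect (Omega y); left; [left|right].
Qed.

Let mKD (D : set (Rn2 R n)) : measurable_fun D f.
Proof. exact: measurable_funTS. Qed.

Lemma measurable_cut E : measurable E -> measurable (cut E).
Proof.
move=> mE; rewrite cutE.
by apply: measurableU; [apply: measurableU|]; apply: measurable_Rn2X;
  apply: measurableI => //; exact: measurableC.
Qed.

(** The three rectangles of [cutE] are pairwise disjoint, so their integrals add up to one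
    integral. *)
Lemma PerE E : measurable E ->
  Per K Omega E = \int[leb2 R n]_(z in cut E) K z.1 z.2.
Proof.
move=> mE; have mCE := measurableC mE; have mCO := measurableC mOmega.
have m1 := measurable_Rn2X (measurableI _ _ mE mOmega) (measurableI _ _ mCE mOmega).
have m2 := measurable_Rn2X (measurableI _ _ mE mOmega) (measurableI _ _ mCE mCO).
have m3 := measurable_Rn2X (measurableI _ _ mE mCO) (measurableI _ _ mCE mOmega).
rewrite cutE !ge0_integral_setU//.
- by apply/disj_setPS => -[x y] /= [[[_ _] [_ Oy]] [_ [_ ?]]].
- exact: measurableU.
- by apply/disj_setPS => -[x y] /= [[[[_ Ox] _]|[[_ Ox] _]] [[_ ?] _]].
Qed.

Lemma Per_ge0 E : 0 <= Per K Omega E.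
Proof.
rewrite /Per /interaction.
by apply: adde_ge0; [apply: adde_ge0|]; apply: integral_ge0 => z _; exact: K0.
Qed.

(** Pairs are counted one by one. A pair of the defect set leaves [E], but leaves neither the
    intersection nor the union: its first point is outside [F], and its second point is in [F]. This
    leaves room for the third term on the left. *)
Lemma Per_submodular E F : measurable E -> measurable F ->
  Per K Omega (E `&` F) + Per K Omega (E `|` F) +
    interaction K ((E `\` F) `&` Omega) ((F `\` E) `&` ~` Omega) <=
  Per K Omega E + Per K Omega F.
Proof.
move=> mE mF; have mI := measurableI _ _ mE mF; have mU := measurableU _ _ mE mF.
set S := ((E `\` F) `&` Omega) `*` ((F `\` E) `&` ~` Omega).
have mS : measurable (S : set (Rn2 R n)).
  apply: measurable_Rn2X; apply: measurableI => //; try exact: measurableD.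
  exact: measurableC.
rewrite !PerE// /interaction; apply: le_integral_multiplicity => //;
  try exact: measurable_cut.
move=> [x y]; rewrite !in_cut.
have -> : ((x, y) \in S) = [&& x \in E, x \notin F, x \in Omega,
    y \in F, y \notin E & y \notin Omega].
  rewrite /S in_setX /= !setDE !in_setI !in_setC.
  by rewrite -!andbA.
rewrite /= !in_setI !in_setU.
(* Membership of [x] and [y] in the three sets decides every count: 64 cases. *)
by case: (x \in E); case: (x \in F); case: (y \in E); case: (y \in F);
   case: (x \in Omega); case: (y \in Omega).
Qed.

End submodularity.

(** * The volume term weighted by [h] *)

Section weighted_volume.
Context d (T : measurableType d) (R : realType) (mu : {measure set T -> \bar R}).
Context (D : set T) (h : T -> R).
Hypothesis mD : measurable D.
Hypothesis inth : mu.-integrable D (fun x => (h x)%:E).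
Implicit Types E F : set T.

Lemma integrable_mul_indic E : measurable E ->
  mu.-integrable D (fun x => (h x * \1_E x)%:E).
Proof.
move=> mE; apply: (le_integrable mD _ _ inth).
  apply/measurable_EFinP; apply: measurable_funM; last exact: measurable_indic.
  exact/measurable_EFinP/(measurable_int _ inth).
move=> x _; rewrite lee_fin normrM ler_piMr// indicE.
by case: (x \in E); rewrite ?normr1 ?normr0.
Qed.

Lemma weighted_volume_ge E : measurable E ->
  - (\int[mu]_(x in D) `|(h x)%:E|) <= \int[mu]_(x in D) (h x * \1_E x)%:E.
Proof.
move=> mE; have iE := integrable_mul_indic mE.
rewrite leeNl; apply: le_trans (lee_abs _) _; rewrite abseN.
apply: le_trans (le_abse_integral _ mD (measurable_int _ iE)) _.
apply: ge0_le_integral => //.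
- by apply: measurableT_comp => //; exact: measurable_int iE.
- by apply: measurableT_comp => //; exact: measurable_int inth.
move=> x _; rewrite lee_fin normrM ler_piMr// indicE.
by case: (x \in E); rewrite ?normr1 ?normr0.
Qed.

Lemma weighted_volume_modular E F : measurable E -> measurable F ->
  \int[mu]_(x in D) (h x * \1_(E `&` F) x)%:E +
  \int[mu]_(x in D) (h x * \1_(E `|` F) x)%:E =
  \int[mu]_(x in D) (h x * \1_E x)%:E + \int[mu]_(x in D) (h x * \1_F x)%:E.
Proof.
move=> mE mF; have mI := measurableI _ _ mE mF; have mU := measurableU _ _ mE mF.
have iE := integrable_mul_indic mE; have iF := integrable_mul_indic mF.
have iI := integrable_mul_indic mI; have iU := integrable_mul_indic mU.
rewrite -(integralD mD iE iF) -(integralD mD iI iU).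
apply: eq_integral => x _; rewrite -!EFinD -!mulrDr !indicE in_setI in_setU.
by case: (x \in E); case: (x \in F); rewrite //= ?addr0 ?add0r.
Qed.

(** Absolute continuity of the integral of |h|: the two volumes differ only on the symmetric
    difference [S], whose measure inside [D] is the L^1 distance of the indicators. *)
Lemma weighted_volume_continuous (e : R) : (0 < e)%R ->
  exists2 r : R, (0 < r)%R & forall E F, measurable E -> measurable F ->
    \int[mu]_(x in D) (`|\1_E x - \1_F x|%R)%:E < r%:E ->
    \int[mu]_(x in D) (h x * \1_F x)%:E <=
    \int[mu]_(x in D) (h x * \1_E x)%:E + e%:E.
Proof.
move=> e0.
have inth' : mu.-integrable setT (EFin \o (h \_ D)).
  by rewrite -restrict_EFin; apply/(integrable_mkcond _ mD).
have [r [r0 Hr]] := integral_normr_continuous inth' e0.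
exists r => // E F mE mF EFr.
pose S := (E `\` F) `|` (F `\` E).
have mS : measurable S by apply: measurableU; exact: measurableD.
have mDS : measurable (D `&` S) by exact: measurableI.
have muDS : mu (D `&` S) < r%:E.
  rewrite setIC -integral_indic//; apply: le_lt_trans EFr.
  rewrite le_eqVlt; apply/orP; left; apply/eqP/eq_integral => x _.
  rewrite !indicE /S !setDE in_setU !in_setI !in_setC.
  by case: (x \in E); case: (x \in F);
    rewrite //= ?subrr ?subr0 ?sub0r ?normrN ?normr0 ?normr1.
have intS : mu.-integrable D (fun x => (`|h x| * \1_S x)%:E).
  apply: (le_integrable mD _ _ (integrable_mul_indic mS)).
    apply/measurable_EFinP; apply: measurable_funM; last exact: measurable_indic.
    by apply: measurableT_comp => //; exact/measurable_EFinP/(measurable_int _ inth).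
  by move=> x _; rewrite lee_fin !normrM normr_id.
have DSe : \int[mu]_(x in D) (`|h x| * \1_S x)%:E <= e%:E.
  rewrite (eq_integral ((fun x => (`|(h \_ D) x|%R)%:E) \_ S)); last first.
    move=> x Dx; rewrite patchE patchE Dx indicE.
    by case: (x \in S); rewrite ?mulr1 ?mulr0.
  rewrite -integral_mkcondr -[leLHS]fineK.
    by rewrite lee_fin ltW//; exact: Hr.
  apply: integrable_fin_num => //; apply: (integrableS measurableT) => //.
  exact: (integrable_abse inth').
(* It remains to integrate the pointwise bound h 1_F <= h 1_E + |h| 1_S. *)
apply: le_trans (leeD2l _ DSe).
have iE := integrable_mul_indic mE; have iF := integrable_mul_indic mF.
rewrite -(integralD mD iE intS); apply: le_integral => //.
  exact: integrableD.
move=> x _; rewrite -EFinD lee_fin !indicE /S !setDE in_setU !in_setI !in_setC.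
case: (x \in E); case: (x \in F);
  rewrite //= ?mulr1 ?mulr0 ?addr0 ?add0r ?ler_norm//.
by rewrite -lerBlDl sub0r -normrN ler_norm.
Qed.

End weighted_volume.

(** * Existence of minimizers by the direct method *)

Lemma limn_einf_le (R : realType) (u : (\bar R)^nat) (c : \bar R) :
  (\forall j \near \oo, u j <= c) -> limn_einf u <= c.
Proof.
move=> uc; rewrite limn_einf_lim; apply: lime_le; first exact: is_cvg_einfs.
apply: filterS uc => j; apply: le_trans.
by apply: ereal_inf_lbound; exists j => /=.
Qed.

Section existence.
Context (R : realType) (n : nat) (Omega : set (Rn R n)).
Context (K : Rn R n -> Rn R n -> \bar R) (h : Rn R n -> R).
Hypothesis mOmega : measurable Omega.
Hypothesis K0 : forall x y, 0 <= K x y.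
Hypothesis inth : (leb R n).-integrable Omega (fun x => (h x)%:E).

Let V (E : set (Rn R n)) := \int[leb R n]_(x in Omega) (h x * \1_E x)%:E.
Let c := \int[leb R n]_(x in Omega) `|(h x)%:E|.

Let V_ge E : measurable E -> - c <= V E.
Proof.
by move=> mE; exact: weighted_volume_ge.
Qed.

Let V_fin E : measurable E -> V E \is a fin_num.
Proof.
move=> mE; apply: integrable_fin_num => //.
exact: integrable_mul_indic.
Qed.

Let c_fin : c \is a fin_num.
Proof. by apply: integrable_fin_num => //; exact: integrable_abse. Qed.

(** The volume term is at least [- c], so the infimum [m] is finite and the perimeters along a
    minimizing sequence are bounded. Compactness gives a limit; the perimeter is lower
    semicontinuous along the subsequence and the volume term is continuous in L^1. *)
Lemma exists_minimizer (G : set (Rn R n)) : compactness_property K Omega ->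
  measurable G -> ae_subset G (~` Omega) ->
  (exists2 E, admissible Omega G E & Per K Omega E < +oo) ->
  exists E, minimizer K h Omega G E.
Proof.
move=> cpt mG GOmega [E1 aE1 PE1].
set m := ereal_inf [set energy K h Omega E | E in admissible Omega G].
have m_fin : m \is a fin_num.
  apply/fin_numPlt/andP; split.
    rewrite (@lt_le_trans _ _ (- c))//; first by rewrite ltNye_eq fin_numN c_fin.
    apply: le_ereal_inf_tmp => _ [E [mE _] <-].
    by rewrite -[leLHS]add0e; apply: leeD; [exact: Per_ge0|exact: V_ge].
  rewrite (@le_lt_trans _ _ (energy K h Omega E1))//.
    by apply: ereal_inf_lbound; exists E1.
  by rewrite lte_add_pinfty// ltey_eq V_fin//; case: aE1.
have /choice[E HE] : forall j : nat, exists E, admissible Omega G E /\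
    energy K h Omega E <= m + (j.+1%:R^-1)%:E.
  move=> j; have j0 : (0 < j.+1%:R^-1 :> R)%R by rewrite invr_gt0.
  by have [_ [E aE <-] /ltW HE] := lb_ereal_inf_adherent j0 m_fin; exists E.
have mEj j : measurable (E j) by have [[]] := HE j.
have Per_bounded : ereal_sup (range (fun j => Per K Omega (E j))) < +oo.
  apply: (@le_lt_trans _ _ (m + 1 + c)); last first.
    by rewrite ltey_eq fin_numD c_fin andbT fin_numD m_fin.
  apply: ge_ereal_sup => _ [j _ <-].
  have [_ HEj] := HE j.
  rewrite -[leLHS]adde0 -(subee c_fin) addeCA addeC leeD2r//.
  apply: le_trans (leeD2l _ (V_ge (mEj j))) _.
  apply: le_trans HEj _; rewrite leeD2l// lee_fin.
  by rewrite invf_le1// ler1n.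
have [s [s_incr [E0 [aE0 EE0 lsc]]]] :=
  cpt G mG GOmega E (fun j => (HE j).1) Per_bounded.
have mE0 : measurable E0 by case: aE0.
exists E0; split => // F aF.
apply: (@le_trans _ _ m); last by apply: ereal_inf_lbound; exists F.
(* One half of [e] pays for the change of the volume term, the other for the distance of the
   energies from [m]. *)
apply/lee_addgt0Pr => e e0; have e20 : (0 < e / 2)%R by rewrite divr_gt0.
have [r r0 Hr] := weighted_volume_continuous mOmega inth e20.
rewrite /energy -/(V E0) -leeBrDr ?V_fin//.
apply: le_trans lsc _; apply: limn_einf_le.
(* Turns the gap 1/(s j + 1) of the subsequence into at most 1/(j + 1). *)
have s_ge j : (j <= s j)%N.
  by elim: j => // j IH; apply: (leq_ltn_trans IH); exact: s_incr.
have /EE0 EE0r : nbhs (0 : \bar R) [set y | y < r%:E].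
  by apply: open_nbhs_nbhs; split; [exact: open_ereal_lt_ereal|rewrite /= lte_fin].
near=> j; rewrite leeBrDr ?V_fin//.
apply: (@le_trans _ _ (Per K Omega (E (s j)) + (V (E (s j)) + (e / 2)%:E))).
  rewrite leeD2l//; apply: Hr => //.
  by near: j; exact: EE0r.
have [_ HEj] := HE (s j).
rewrite addeA (_ : m + e%:E = m + (e / 2)%:E + (e / 2)%:E); last first.
  by rewrite -addeA -EFinD -splitr.
rewrite leeD2r//.
apply: le_trans HEj _; rewrite leeD2l// lee_fin.
apply: (@le_trans _ _ (j.+1%:R^-1)%R).
  by rewrite lef_pV2 ?posrE// ler_nat ltnS.
by apply/ltW; near: j; exact: near_infty_natSinv_lt (PosNum e20).
Unshelve. all: by end_near. Qed.

End existence.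

(** * Comparison of minimizers for ordered exterior data *)

Section comparison.
Context (R : realType) (n : nat) (Omega : set (Rn R n)).
Context (K : Rn R n -> Rn R n -> \bar R) (h : Rn R n -> R).
Hypothesis mOmega : measurable Omega.
Hypothesis mK : measurable_fun [set: Rn2 R n] (fun z => K z.1 z.2).
Hypothesis K0 : forall x y, 0 <= K x y.
Hypothesis inth : (leb R n).-integrable Omega (fun x => (h x)%:E).
Implicit Types E F G : set (Rn R n).

Local Notation ae := (almost_everywhere (leb R n)).

Lemma admissibleI G1 G2 E F : ae_subset G1 G2 ->
  admissible Omega G1 E -> admissible Omega G2 F -> admissible Omega G1 (E `&` F).
Proof.
move=> G12 [mE EG] [mF FG]; split; first exact: measurableI.
apply: (@filterS3 _ ae) G12 EG FG => x G12 /= EG FG; split=> [[[Ex _] Ox]|G1x].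
  exact/EG.
have [Ex Ox] := EG.2 G1x; have [Fx _] := FG.2 (G12 G1x).
by split.
Qed.

Lemma admissibleU G1 G2 E F : ae_subset G1 G2 ->
  admissible Omega G1 E -> admissible Omega G2 F -> admissible Omega G2 (E `|` F).
Proof.
move=> G12 [mE EG] [mF FG]; split; first exact: measurableU.
apply: (@filterS3 _ ae) G12 EG FG => x G12 /= EG FG; split=> [[[Ex|Fx] Ox]|G2x].
- exact/G12/EG.
- exact/FG.
- by have [Fx Ox] := FG.2 G2x; split => //; right.
Qed.

Lemma energy_submodular E F : measurable E -> measurable F ->
  energy K h Omega (E `&` F) + energy K h Omega (E `|` F) +
    interaction K ((E `\` F) `&` Omega) ((F `\` E) `&` ~` Omega) <=
  energy K h Omega E + energy K h Omega F.
Proof.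
move=> mE mF; rewrite /energy.
rewrite [X in X + _ <= _]addeACA [leRHS]addeACA.
rewrite (weighted_volume_modular mOmega inth mE mF) addeAC leeD2r//.
exact: Per_submodular.
Qed.

(** Finiteness is what later permits cancelling energies in the extended reals. *)
Lemma energy_fin_num G E : minimizer K h Omega G E ->
  (exists2 F, admissible Omega G F & Per K Omega F < +oo) ->
  energy K h Omega E \is a fin_num.
Proof.
move=> [[mE _] minE] [F aF PF].
have V_fin A : measurable A ->
    \int[leb R n]_(x in Omega) (h x * \1_A x)%:E \is a fin_num.
  by move=> mA; apply: integrable_fin_num => //; exact: integrable_mul_indic.
rewrite fin_numElt; apply/andP; split.
  rewrite (@lt_le_trans _ _ (0 + \int[leb R n]_(x in Omega) (h x * \1_E x)%:E))//.
    by rewrite add0e ltNye_eq V_fin.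
  by rewrite leeD2r//; exact: Per_ge0.
rewrite (le_lt_trans (minE _ aF))// lte_add_pinfty// ltey_eq V_fin//.
by case: aF.
Qed.

(** Minimality bounds the energies of the intersection and the union from below by those of [E] and
    [F], and submodularity bounds their sum plus the defect from above, so equality holds
    throughout. The case [G1 = G2] is included. *)
Lemma minimizers_cap_cup G1 G2 E F : ae_subset G1 G2 ->
  minimizer K h Omega G1 E -> minimizer K h Omega G2 F ->
  energy K h Omega E \is a fin_num -> energy K h Omega F \is a fin_num ->
  [/\ minimizer K h Omega G1 (E `&` F), minimizer K h Omega G2 (E `|` F) &
    interaction K ((E `\` F) `&` Omega) ((F `\` E) `&` ~` Omega) = 0].
Proof.
move=> G12 [aE minE] [aF minF] finE finF.
have aI := admissibleI G12 aE aF; have aU := admissibleU G12 aE aF.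
have sub := energy_submodular aE.1 aF.1.
have EI := minE _ aI; have FU := minF _ aU.
have D0 : 0 <= interaction K ((E `\` F) `&` Omega) ((F `\` E) `&` ~` Omega).
  by apply: integral_ge0 => z _; exact: K0.
have IU : energy K h Omega (E `&` F) + energy K h Omega (E `|` F) <=
    energy K h Omega E + energy K h Omega F.
  by apply: le_trans sub; rewrite leeDl.
(* Replace the energy of the union by the smaller one of [F], then cancel it. *)
have IE : energy K h Omega (E `&` F) <= energy K h Omega E.
  by rewrite -(leeD2rE _ _ finF); apply: le_trans IU; rewrite leeD2l.
have UF : energy K h Omega (E `|` F) <= energy K h Omega F.
  by rewrite -(leeD2lE _ _ finE); apply: le_trans IU; rewrite leeD2r.
split.
- by split=> // A aA; rewrite (le_trans IE)// minE.
- by split=> // A aA; rewrite (le_trans UF)// minF.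
apply/eqP; rewrite eq_le D0 andbT.
have finEF : energy K h Omega E + energy K h Omega F \is a fin_num.
  by rewrite fin_numD finE.
rewrite -(leeD2lE _ _ finEF) adde0; apply: le_trans sub.
by rewrite leeD2r// leeD.
Qed.

Hypothesis K_gt0 : \forall z \ae leb2 R n,
  (Omega `*` ~` Omega : set (Rn2 R n)) z -> 0 < K z.1 z.2.

(** A vanishing integral makes [K] zero a.e. on the rectangle, where it is also positive a.e.; the
    rectangle is therefore null, and so is one of its sides. *)
Lemma interaction_eq0 A B : measurable A -> measurable B ->
  A `<=` Omega -> B `<=` ~` Omega -> interaction K A B = 0 ->
  leb R n A = 0 \/ leb R n B = 0.
Proof.
move=> mA mB AO BO AB0; apply: leb2X_eq0 => //.
have mAB := measurable_Rn2X mA mB.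
apply: measure_negligible => //.
have : \int[leb2 R n]_(z in (A `*` B : set (Rn2 R n))) `|K z.1 z.2| = 0.
  by rewrite -[RHS]AB0; apply: eq_integral => z _; rewrite gee0_abs.
move=> /(ae_eq_integral_abs _ mAB (measurable_funTS mK)) KAB0.
apply: negligibleS (filterI KAB0 K_gt0) => -[x y] /= [Ax By] [Kxy0 Kxy].
have := Kxy (conj (AO _ Ax) (BO _ By)).
by rewrite Kxy0// ltxx.
Qed.

Lemma minimizers_nested G1 G2 E F : ae_proper G1 G2 ->
  minimizer K h Omega G1 E -> minimizer K h Omega G2 F ->
  energy K h Omega E \is a fin_num -> energy K h Omega F \is a fin_num ->
  leb R n (E `&` Omega) <= leb R n (F `&` Omega).
Proof.
move=> [G12 nG12] mnE mnF finE finF.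
have [_ _ D0] := minimizers_cap_cup G12 mnE mnF finE finF.
have [[mE EG] _] := mnE; have [[mF FG] _] := mnF.
have mA : measurable ((E `\` F) `&` Omega).
  by apply: measurableI => //; exact: measurableD.
have mB : measurable ((F `\` E) `&` ~` Omega).
  by apply: measurableI; [exact: measurableD|exact: measurableC].
have [A0|B0] := interaction_eq0 mA mB (@subIsetr _ _ _) (@subIsetr _ _ _) D0.
  have mFO := measurableI _ _ mF mOmega.
  (* Inside [Omega], [E] is covered by [F] and the null set [E] minus [F]. *)
  rewrite -(measureU0 mFO mA A0); apply: le_measure; rewrite ?inE//.
  - exact: measurableI.
  - exact: measurableU.
  move=> x [Ex Ox]; have [Fx|Fx] := pselect (F x); by [left|right].
(* Outside [Omega], a point of [G2] lies in [F], hence a.e. in [E] and so in [G1]: the data would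
   coincide. *)
exfalso; apply: nG12.
have nB : \forall x \ae leb R n, ~ ((F `\` E) `&` ~` Omega) x.
  by exists ((F `\` E) `&` ~` Omega); split => // x; rewrite /= notK.
apply: (@filterS3 _ ae) (@filterI _ ae _ _ _ EG FG) G12 nB.
move=> x [/= EGx FGx] /= G12x nBx.
split=> // G2x; have [Fx Ox] := FGx.2 G2x.
by apply/EGx; split => //; apply: contrapT => Ex; apply: nBx.
Qed.

(** Outside [Omega] both sets agree with [G], so their difference is visible inside. If the two
    finite volumes were equal, the symmetric difference would be null there. *)
Lemma minimizers_lt_cap_cup G E F : leb R n Omega < +oo ->
  admissible Omega G E -> admissible Omega G F -> ~ ae_eqset E F ->
  leb R n ((E `&` F) `&` Omega) < leb R n ((E `|` F) `&` Omega).
Proof.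
move=> Omegaoo [mE EG] [mF FG] nEF.
have mI : measurable ((E `&` F) `&` Omega) by do 2 apply: measurableI => //.
have mU : measurable ((E `|` F) `&` Omega).
  by apply: measurableI => //; exact: measurableU.
have IU : (E `&` F) `&` Omega `<=` (E `|` F) `&` Omega.
  by move=> x [[Ex _] Ox]; split => //; left.
have Uoo : leb R n ((E `|` F) `&` Omega) < +oo.
  by apply: le_lt_trans Omegaoo; apply: le_measure; rewrite ?inE.
rewrite ltNge; apply/negP => UI; apply: nEF.
have D0 : leb R n (((E `|` F) `&` Omega) `\` ((E `&` F) `&` Omega)) = 0.
  have eqUI : leb R n ((E `|` F) `&` Omega) = leb R n ((E `&` F) `&` Omega).
    by apply/eqP; rewrite eq_le UI/=; apply: le_measure; rewrite ?inE.
  rewrite [LHS](measureD mU mI Uoo) (setIidr IU).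
  rewrite -[LHS]/(leb R n ((E `|` F) `&` Omega) - leb R n ((E `&` F) `&` Omega)).
  by rewrite -eqUI subee// ge0_fin_numE.
have nD : \forall x \ae leb R n,
    ~ (((E `|` F) `&` Omega) `\` ((E `&` F) `&` Omega)) x.
  exists (((E `|` F) `&` Omega) `\` ((E `&` F) `&` Omega)).
  by split => // [|x]; [exact: measurableD|rewrite /= notK].
apply: (@filterS3 _ ae) EG FG nD => x /= EGx FGx nDx.
have [Ox|Ox] := pselect (Omega x); last first.
  split=> [Ex|Fx].
    by have [] := FGx.2 (EGx.1 (conj Ex Ox)).
  by have [] := EGx.2 (FGx.1 (conj Fx Ox)).
split=> [Ex|Fx]; apply: contrapT => nx; apply: nDx.
  by split; [split => //; left|move=> [[]]].
by split; [split => //; right|move=> [[]]].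
Qed.

End comparison.

(** * Countability of the parameters without uniqueness *)

Theorem proposition2p6 (R : realType) (n : nat)
    (Omega : set (Rn R n)) (K : Rn R n -> Rn R n -> \bar R)
    (h : Rn R n -> R) (I : set R) (G : R -> set (Rn R n)) :
  measurable Omega -> boundedRn Omega ->
  symmetric_kernel K ->
  compactness_property K Omega ->
  (\forall z \ae leb2 R n,
     (Omega `*` ~` Omega : set (Rn2 R n)) z -> 0 < K z.1 z.2) ->
  (leb R n).-integrable Omega (fun x => (h x)%:E) ->
  (forall t, I t -> measurable (G t) /\ ae_subset (G t) (~` Omega)) ->
  (forall t, I t -> exists2 E, admissible Omega (G t) E & Per K Omega E < +oo) ->
  (forall tau t, I tau -> I t -> (tau < t)%R -> ae_proper (G tau) (G t)) ->
  countable [set t | I t /\ ~ has_unique_minimizer K h Omega (G t)].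
Proof.
move=> mOmega bOmega [mK K0 _] cpt K_gt0 inth GP Gfin Gmono.
have Omegaoo := leb_bounded_lty mOmega bOmega.
have fin t E : I t -> minimizer K h Omega (G t) E ->
    energy K h Omega E \is a fin_num.
  by move=> It mnE; apply: energy_fin_num mnE (Gfin _ It).
pose gap t (q : rat) E F := [/\ minimizer K h Omega (G t) E,
  minimizer K h Omega (G t) F, leb R n (E `&` Omega) < (ratr q)%:E &
  (ratr q)%:E < leb R n (F `&` Omega)].
have /choice[q Hq] : forall t, exists q,
    I t /\ ~ has_unique_minimizer K h Omega (G t) -> exists E F, gap t q E F.
  (* [q] is chosen on all of [R]; at the other parameters its value 0 is a dummy. *)
  move=> t; have [[It nu]|] := pselect (I t /\ ~ has_unique_minimizer K h Omega (G t));
    last by exists 0%R.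
  have [mG GO] := GP _ It.
  have [E mnE] := exists_minimizer mOmega K0 inth cpt mG GO (Gfin _ It).
  (* Since a minimizer exists, failure of uniqueness means a second, different one. *)
  have [F [mnF nFE]] : exists F, minimizer K h Omega (G t) F /\ ~ ae_eqset F E.
    apply: contrapT => H; apply: nu; exists E => // F mnF.
    by apply: contrapT => nFE; apply: H; exists F.
  have GG : ae_subset (G t) (G t) by apply: aeW => x.
  have [mnI mnU _] := minimizers_cap_cup mOmega mK K0 inth GG mnF mnE
    (fin _ _ It mnF) (fin _ _ It mnE).
  have lt_IU := minimizers_lt_cap_cup mOmega Omegaoo mnF.1 mnE.1 nFE.
  have lebfin A : measurable A -> leb R n (A `&` Omega) \is a fin_num.
    move=> mA; rewrite ge0_fin_numE//; apply: le_lt_trans Omegaoo.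
    by apply: le_measure; rewrite ?inE//; exact: measurableI.
  have finI := lebfin _ mnI.1.1; have finU := lebfin _ mnU.1.1.
  have /rat_in_itvoo[p] := fine_lt finI finU lt_IU.
  rewrite in_itv/= => /andP[p1 p2].
  exists p => _; exists (F `&` E), (F `|` E).
  split; [exact: mnI|exact: mnU|by rewrite -(fineK finI) lte_fin|].
  by rewrite -(fineK finU) lte_fin.
have q_incr tau t : I tau /\ ~ has_unique_minimizer K h Omega (G tau) ->
    I t /\ ~ has_unique_minimizer K h Omega (G t) -> (tau < t)%R ->
    (q tau < q t)%R.
  move=> Htau Ht taut.
  have [E1 [F1 [_ mnF1 _ qF1]]] := Hq _ Htau.
  have [E2 [F2 [mnE2 _ qE2 _]]] := Hq _ Ht.
  (* The larger minimizer for [tau] is compared with the smaller one for [t]: q tau < |F1 in Omega|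
     <= |E2 in Omega| < q t. *)
  rewrite -(ltr_rat R) -lte_fin (lt_le_trans qF1)// (le_trans _ (ltW qE2))//.
  apply: (minimizers_nested mOmega mK K0 inth K_gt0
    (Gmono _ _ Htau.1 Ht.1 taut) mnF1 mnE2).
  - exact: fin Htau.1 mnF1.
  - exact: fin Ht.1 mnE2.
(* Being strictly increasing on the exceptional set, [q] is injective there; [pickle] encodes
   rationals as naturals. *)
apply/countable_injP; exists (pickle \o q) => tau t /set_mem Htau /set_mem Ht.
move=> /(pcan_inj pickleK) qE.
have [taut|ttau|//] := ltgtP tau t.
- by have := q_incr _ _ Htau Ht taut; rewrite qE ltxx.
- by have := q_incr _ _ Ht Htau ttau; rewrite qE ltxx.
Qed.
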